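(* Let $\|\cdot\|$ be any norm on $\mathbb{R}^d$, let $m\geq 2$, and let $M$ be a non-empty finite set of $m$-gons in $\mathbb{R}^d$. Let $\mathcal{H}(M)$ be the hypergraph with vertex set $\mathbb{R}^d$ and edge set $\{X\subseteq\mathbb{R}^d\mid X \text{ is congruent in } (\mathbb{R}^d,\|\cdot\|) \text{ to some } T\in M\}$. Then there exists a finite set $S$ of $(m+1)$-gons in $\mathbb{R}^d$ such that $\mathcal{H}(M)$ is equivalent to the $(m+1)$-uniform hypergraph $\mathcal{H}(S)$ with vertex set $\mathbb{R}^d$ and edge set $\{Y\subseteq\mathbb{R}^d\mid Y\text{ is congruent in } (\mathbb{R}^d,\|\cdot\|) \text{ to some element of } S\}$.
   Context: Two sets $X,Y\subseteq\mathbb{R}^d$ are congruent in $(\mathbb{R}^d,\|\cdot\|)$ iff one is the image of the other under a composition, in either order, of a surjective linear isometry of $(\mathbb{R}^d,\|\cdot\|)$ and a translation. An $m$-gon is any subset of $\mathbb{R}^d$ of cardinality exactly $m$. A hypergraph is $(V,E)$ with edges subsets of $V$ of size at least $2$; a proper coloring $\varphi:V\to C$ makes no edge monochromatic; $\chi$ is the least $|C|$ admitting a proper coloring. Two hypergraphs $\mathcal{H},\mathcal{G}$ on the same vertex set are equivalent if $\chi(\mathcal{H})=\chi(\mathcal{G})$ and, for every set $C$ of that cardinality, a map into $C$ is a proper coloring of $\mathcal{H}$ iff it is a proper coloring of $\mathcal{G}$. *)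

(* Defs.v *)
From HB Require Import structures.
From mathcomp Require Import all_boot all_order all_algebra.
From mathcomp Require Import boolp classical_sets cardinality Rstruct.
From Stdlib Require Import Reals.
Set Implicit Arguments. Unset Strict Implicit. Unset Printing Implicit Defensive.
Import Order.TTheory GRing.Theory Num.Theory.
Local Open Scope ring_scope.
Local Open Scope classical_set_scope.

Notation Rd d := 'rV[R]_d.

Definition is_norm (d : nat) (N : Rd d -> R) : Prop :=
  (forall x : Rd d, N x = 0 -> x = 0) /\
  (forall (a : R) (x : Rd d), N (a *: x) = `|a| * N x) /\
  (forall x y : Rd d, N (x + y) <= N x + N y).

Definition surj_lin_isometry (d : nat) (N : Rd d -> R) (f : Rd d -> Rd d) : Prop :=
  (forall x y : Rd d, f (x + y) = f x + f y) /\
  (forall (a : R) (x : Rd d), f (a *: x) = a *: f x) /\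
  (forall x : Rd d, N (f x) = N x) /\
  (forall y : Rd d, exists x, f x = y).

Definition image_by_motion (d : nat) (N : Rd d -> R) (X Y : set (Rd d)) : Prop :=
  exists f t, surj_lin_isometry N f /\
    (Y = (fun x => f x + t) @` X \/ Y = (fun x => f (x + t)) @` X).

Definition congruent (d : nat) (N : Rd d -> R) (X Y : set (Rd d)) : Prop :=
  image_by_motion N X Y \/ image_by_motion N Y X.

Definition mgon (d m : nat) (X : set (Rd d)) : Prop := (X #= `I_m)%card.

Definition hypergraph (V : Type) := set (set V).

Definition congr_hypergraph (d : nat) (N : Rd d -> R) (M : set (set (Rd d)))
  : hypergraph (Rd d) :=
  [set X | exists2 T, M T & congruent N X T].

Definition proper_coloring (V C : Type) (H : hypergraph V) (phi : V -> C) : Prop :=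
  forall E, H E -> ~ (exists c : C, forall x, E x -> phi x = c).

Definition colorable (V : Type) (H : hypergraph V) (C : Type) : Prop :=
  exists phi : V -> C, proper_coloring H phi.

Definition card_le_type (A B : Type) : Prop :=
  exists f : A -> B, injective f.
Definition card_eq_type (A B : Type) : Prop :=
  exists f : A -> B, bijective f.

(* C has cardinality chi(H): C admits a proper coloring of H and |C| is least
   among all such colour sets. *)
Definition chromatic_type (V : Type) (H : hypergraph V) (C : Type) : Prop :=
  colorable H C /\ forall D : Type, colorable H D -> card_le_type C D.

(* Equivalence of hypergraphs on the same vertex set: chi(H) = chi(G)
   (witnessed by a common set C of that cardinality) and, for every set D of
   that cardinality, a map into D is a proper coloring of H iff it is a proper
   coloring of G. *)
Definition hyp_equivalent (V : Type) (H G : hypergraph V) : Prop :=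
  exists C : Type, chromatic_type H C /\ chromatic_type G C /\
    forall D : Type, card_eq_type C D ->
      forall phi : V -> D, proper_coloring H phi <-> proper_coloring G phi.

(* Main.v *)
(* The chromatic number k of H(M) is finite: N is comparable to the sup norm, so
   a periodic coloring of a fine cubic grid avoids any given N-distance.  By
   de Bruijn-Erdos compactness some finite set F contains a monochromatic edge
   of H(M) under every (k-1)-coloring.  Let U be the union of all T in M and of k
   pairwise disjoint translates of F avoiding them, and let S consist of the
   (m+1)-point subsets of U containing an edge of H(M).  Suppose a k-coloring
   without monochromatic S-copies has a monochromatic copy of some T in M; move
   it onto T itself.  A color class of U containing an edge of H(M) cannot contain
   any further point, so each translate of F misses the color of T, hence
   contains a monochromatic edge, and these k edges and T carry k+1 distinct
   colors. *)
From Stdlib Require Import Reals.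
Require Import Defs.
From mathcomp Require Import all_boot all_order all_algebra.
From mathcomp Require Import finmap.
From mathcomp Require Import boolp classical_sets cardinality Rstruct.
From mathcomp Require Import filter reals topology normedtype derive.
From mathcomp Require Import lra zify.
Set Implicit Arguments.
Unset Strict Implicit.
Unset Printing Implicit Defensive.
Import Order.TTheory GRing.Theory Num.Theory numFieldNormedType.Exports.
Local Open Scope ring_scope.
Local Open Scope classical_set_scope.

(** * Norms on a finite-dimensional space and colorings avoiding a distance *)

Lemma coord_le_mx_norm (K : realType) (d : nat) (x : 'rV[K]_d) i : `|x 0 i| <= `|x|.
Proof.
by rewrite [leRHS]/Num.norm/= mx_normrE; apply/bigmax_geP; right; exists (0, i).
Qed.

(** Equal floors put [a] and [b] in one unit interval. Distinct congruent floors differ by at least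
    [L.+1], and passing back from floors to reals loses less than 1. *)
Lemma floor_modn_eq (K : realType) (L : nat) (a b : K) :
  (Num.floor a = Num.floor b %[mod L.+1%:Z])%Z ->
  `|a - b| < 1 \/ L%:R < `|a - b|.
Proof.
have /andP[la ua] := floor_itv a; have /andP[lb ub] := floor_itv b.
move: (Num.floor a) (Num.floor b) la ua lb ub => p q.
rewrite !intrD => la ua lb ub /eqP.
have [pq|npq] := eqVneq p q.
  by left; rewrite pq in la ua; rewrite ltr_norml; apply/andP; split; lra.
rewrite eqz_mod_dvd => dvd; right.
have : (L.+1 <= `|p - q|)%N by rewrite dvdn_leq// absz_gt0 subr_eq0.
rewrite -lez_nat abszE -(ler_int K) intr_norm intrB -pmulrn.
rewrite -natr1 ler_normr ltr_normr => /orP[] far; apply/orP; [left|right]; lra.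
Qed.

Section Norm.
Context {K : realType} {d : nat} (N : 'rV[K]_d -> K).
Hypothesis N_eq0 : forall x, N x = 0 -> x = 0.
Hypothesis NZ : forall a x, N (a *: x) = `|a| * N x.
Hypothesis ND : forall x y, N (x + y) <= N x + N y.

Lemma gauge0 : N 0 = 0.
Proof. by rewrite -(scale0r 0) NZ normr0 mul0r. Qed.

Lemma gaugeN x : N (- x) = N x.
Proof. by rewrite -scaleN1r NZ normrN1 mul1r. Qed.

Lemma gauge_ge0 x : 0 <= N x.
Proof.
by have := ND x (- x); rewrite subrr gauge0 gaugeN -mulr2n pmulrn_lge0.
Qed.

Lemma gauge_le_coord (b : K) (x : 'rV[K]_d) : (forall i, `|x 0 i| <= b) ->
  N x <= b * \sum_i N (delta_mx 0 i).
Proof.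
move=> xb; rewrite {1}[x]row_sum_delta mulr_sumr.
apply: (big_ind2 (fun u a => N u <= a)) => [|u a v c ua vc|i _]; first by rewrite gauge0.
  by rewrite (le_trans (ND _ _))// lerD.
by rewrite NZ ler_wpM2r// gauge_ge0.
Qed.

(** [N] is Lipschitz for the sup norm with constant [A]. The proof divides by [A + 1] because [A]
    may vanish. *)
Lemma gauge_continuous : continuous N.
Proof.
pose A := \sum_i N (delta_mx 0 i).
have A0 : 0 <= A by apply: sumr_ge0 => i _; exact: gauge_ge0.
have NA x : N x <= `|x| * A by apply: gauge_le_coord => i; exact: coord_le_mx_norm.
have A1 : 0 < A + 1 by rewrite ltr_wpDl.
move=> x; have FF : Filter (nbhs (x : 'M[K]_(1, d))) by exact: nbhs_filter.
apply/(@cvgrPdist_lt K _ _ _ FF) => e e0.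
have /= := @nbhsx_ballx K 'M[K]_(1, d) x _ (divr_gt0 e0 A1).
apply: filterS => y; rewrite -ball_normE /= => xy.
have dist : `|N x - N y| <= N (x - y).
  rewrite ler_distl; apply/andP; split.
    by rewrite lerBlDr; have := ND (y - x) x; rewrite subrK -opprB gaugeN addrC.
  by have := ND (x - y) y; rewrite subrK addrC.
apply: le_lt_trans dist _; apply: le_lt_trans (NA _) _.
apply: (@le_lt_trans _ _ (`|x - y| * (A + 1))).
  by rewrite ler_wpM2l// lerDl.
rewrite -ltr_pdivlMr//; exact.
Qed.

(* c is the minimum of N over the unit sphere of the sup norm. *)
Lemma coord_le_gauge :
  exists2 c : K, 0 < c & forall (x : 'rV[K]_d) i, c * `|x 0 i| <= N x.
Proof.
pose S := [set x : 'rV[K]_d | `|x| = 1].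
(* An empty unit sphere means that the space is zero, since any nonzero vector could be normalized;
   then every constant works. *)
have [S0|/set0P[x0 Sx0]] := eqVneq S set0.
  exists 1 => // x i; rewrite mul1r.
  have [->|x0] := eqVneq x 0; first by rewrite mxE normr0 gauge_ge0.
  suff : S (`|x|^-1 *: x) by rewrite S0.
  by rewrite /S /= normrZ normfV normr_id mulVf// normr_eq0.
have compS : compact S.
  apply: bounded_closed_compact.
    by exists 1; split => // M M1 x /= ->; exact: ltW.
  have -> : S = (fun x : 'rV[K]_d => `|x|) @^-1` [set 1] by [].
  apply: (@closed_comp _ _ (fun x : 'rV[K]_d => `|x|)).
    by move=> x _; exact: norm_continuous.
  exact: closed_eq.
have [|c /set_mem Sc cmin] := @EVT_min_rV K d N S (ex_intro _ x0 Sx0) compS.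
  by apply: continuous_subspaceT => ?; exact: gauge_continuous.
exists (N c) => [|x i].
  rewrite lt_neqAle gauge_ge0 andbT eq_sym; apply/eqP => /N_eq0 c0.
  by move: Sc; rewrite /S/= c0 normr0 => /eqP; rewrite eq_sym oner_eq0.
have [->|x0n] := eqVneq x 0; first by rewrite mxE normr0 mulr0 gauge_ge0.
have nx : 0 < `|x| by rewrite normr_gt0.
have := cmin (`|x|^-1 *: x); rewrite inE /S /= normrZ normfV normr_id.
rewrite mulVf ?gt_eqF// => /(_ erefl).
rewrite NZ normfV normr_id mulrC ler_pdivlMr//; apply: le_trans.
by rewrite ler_wpM2l ?gauge_ge0// coord_le_mx_norm.
Qed.

(** Color the cubic grid of side [s^-1] with period [L.+1] in each coordinate. Points of one color
    either differ by at most [s^-1] in every coordinate, so that their distance is at most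
    [A / s = r * A / (A + 1) < r], or differ by more than [L / s > r / c] in some coordinate, so
    that their distance exceeds [r]. *)
Lemma distance_coloring (r : K) : 0 < r ->
  exists (C : finType) (phi : 'rV[K]_d -> C),
    forall x y, N (x - y) = r -> phi x <> phi y.
Proof.
move=> r0; have [c c0 cN] := coord_le_gauge.
pose A := \sum_i N (delta_mx 0 i).
have A0 : 0 <= A by apply: sumr_ge0 => i _; exact: gauge_ge0.
have A1 : 0 < A + 1 by rewrite ltr_wpDl.
pose s := (A + 1) / r; have s0 : 0 < s by rewrite divr_gt0.
pose L := (Num.truncn (r * s / c)).+1.
exists {ffun 'I_d -> 'I_L.+1}.
exists (fun x : 'rV[K]_d => [ffun i => inord `|(Num.floor (s * x 0 i)%R %% L.+1%:Z)%Z|%N]).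
move=> x y Nxy /ffunP eq_col.
have cell i : `|s * x 0 i - s * y 0 i| < 1 \/ L%:R < `|s * x 0 i - s * y 0 i|.
  apply: floor_modn_eq; have := congr1 (@nat_of_ord _) (eq_col i); rewrite !ffunE.
  have lt_mod (z : int) : (`|(z %% L.+1%:Z)%Z| < L.+1)%N.
    by rewrite -ltz_nat gez0_abs ?modz_ge0// ltz_pmod.
  rewrite !inordK ?lt_mod// => /(congr1 Posz).
  by rewrite !gez0_abs ?modz_ge0.
have scale i : `|s * x 0 i - s * y 0 i| = s * `|(x - y) 0 i|.
  by rewrite -mulrBr normrM gtr0_norm// !mxE.
have [close|] := pselect (forall i : 'I_d, `|(x - y) 0 i| <= s^-1).
  have := gauge_le_coord close; rewrite Nxy -/A /s invf_div.
  by rewrite mulrAC ler_pdivlMr// ler_pM2l// gerDl ler10.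
apply; move=> i; rewrite -[s^-1]mul1r ler_pdivlMr// mulrC -scale.
have [/ltW//|far] := cell i.
have := cN (x - y) i; rewrite Nxy leNgt => /negP[].
rewrite mulrC -ltr_pdivrMr// -(ltr_pM2l s0) -scale mulrCA mulrA.
by apply: lt_trans far; rewrite /L; exact: truncnS_gt.
Qed.

End Norm.

(** * Finite sets, changes of color set, and compactness *)

Lemma finite_powerset (V : choiceType) (A : set V) :
  finite_set A -> finite_set [set B | B `<=` A].
Proof.
move=> finA; apply: sub_finite_set (finite_image (fun D : {fset V} => [set` D])
  (finite_fset (fpowerset (fset_set A)))) => B /= BA.
have finB := sub_finite_set BA finA.
by exists (fset_set B); [rewrite /= fpowersetE -fset_set_sub|rewrite fset_setK].
Qed.

Lemma proper_coloring_inj (V C D : Type) (H : hypergraph V) (phi : V -> C)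
    (g : C -> D) : injective g -> V ->
  proper_coloring H (g \o phi) <-> proper_coloring H phi.
Proof.
move=> g_inj v; split=> prop E HE [c Ec]; apply: (prop E HE).
  by exists (g c) => x /Ec /= ->.
have [[x Ex]|E0] := pselect (exists x, E x).
  by exists (phi x) => y Ey; apply: g_inj; exact: etrans (Ec _ Ey) (esym (Ec _ Ex)).
(* An empty edge is monochromatic in any color; the point [v] provides one in [C]. *)
by exists (phi v) => x Ex; case: E0; exists x.
Qed.

(** By induction: an injection of ['I_n] into [D] is either onto, and a section of it embeds [D] in
    ['I_n], or misses a point, which extends it to ['I_n.+1]. This reduces minimality among
    arbitrary color types to finite ones. *)
Lemma card_le_ord_total (D : Type) n :
  card_le_type 'I_n D \/ exists2 p, (p < n)%N & card_le_type D 'I_p.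
Proof.
elim: n => [|n [[f f_inj]|[p pn Dp]]].
- by left; exists (fun i : 'I_0 => False_rect D (notF (ltn_ord i))) => -[].
- have [f_surj|] := pselect (forall y, exists i, f i = y).
    right; exists n => //; have [g gP] := choice f_surj.
    by exists g; exact: can_inj gP.
  move=> /existsNP[y ny]; left.
  exists (fun i => if unlift ord_max i is Some j then f j else y) => i j.
  case: unliftP => [i' ->|->]; case: unliftP => [j' ->|->] //.
  + by move/f_inj->.
  + by move=> e; case: ny; exists i'.
  + by move=> e; case: ny; exists j'.
- by right; exists p => //; exact: ltnW.
Qed.

Lemma de_Bruijn_Erdos (V : choiceType) (C : finType) (H : hypergraph V) :
  (forall E, H E -> finite_set E) ->
  (forall F, finite_set F -> colorable [set E | H E /\ E `<=` F] C) ->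
  colorable H C.
Proof.
move=> finH finC.
have /choice[psi psiP] F : exists phi : V -> C,
    finite_set F -> proper_coloring [set E | H E /\ E `<=` F] phi.
  have [/finC[phi phiP]|nF] := pselect (finite_set F); first by exists phi.
  by have [phi _] := finC _ (finite_set0 V); exists phi => /nF.
(* An ultrafilter on finite subsets of V selects the color of each vertex. *)
pose above (F : set V) := [set G | finite_set G /\ F `<=` G].
have above_proper : ProperFilter (filter_from finite_set above).
  apply: filter_from_proper => [|F finF]; last by exists F; split.
  apply: filter_from_filter => [|F G finF finG]; first by exists set0; exact: finite_set0.
  exists (F `|` G); first by rewrite finite_setU.
  by move=> B [finB]; rewrite subUset => -[FB GB]; split; split.
have [U [ultraU subU]] := ultraFilterLemma above_proper.
(* If no color were selected, [U] would contain for each [c] the set where [psi F x] differs from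
   [c]; as [C] is finite, it would contain their intersection, which is empty. *)
have /choice[phi phiP] x : exists c, U [set F | psi F x = c].
  apply: contrapT => noc.
  have /filter_ex[F /(_ (psi F x)) []//] : U [set F | forall c, ~ psi F x = c].
  apply: filter_forall => c.
  by have [Uc|//] := in_ultra_setVsetC [set F | psi F x = c] ultraU;
    case: noc; exists c.
exists phi => E HE [c Ec].
(* The edge is finite, so some finite [F] containing it has [psi F] equal to [phi] on all of it. *)
have /filter_bigI : forall x, x \in fset_set E -> U [set F | psi F x = phi x].
  by move=> x _; exact: phiP.
have UE : U (above E) by apply: subU; exists E => //; exact: finH.
move=> /(filterI UE)/filter_ex[F [[finF EF] psiE]].
apply: (psiP F finF E) => //; exists c => x Ex; rewrite -(Ec x Ex).
by apply: psiE => /=; rewrite in_fset_set ?inE//; exact: finH.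
Qed.

(** * Motions, congruence and finite colorability *)

Section Motions.
Context {d : nat} (N : 'rV[R]_d -> R).
Hypothesis normN : is_norm N.

(** One order of composition suffices: by linearity [g (x + t) = g x + g t]. *)
Definition motion (f : 'rV[R]_d -> 'rV[R]_d) : Prop :=
  exists g t, surj_lin_isometry N g /\ f = (fun x => g x + t).

Lemma surj_lin_isometry_id : surj_lin_isometry N idfun.
Proof. by do 3!split=> //; move=> y; exists y. Qed.

Lemma surj_lin_isometryB g x y :
  surj_lin_isometry N g -> g (x - y) = g x - g y.
Proof. by move=> [gD [gZ _]]; rewrite gD -scaleN1r gZ scaleN1r. Qed.

Lemma motion_shift t : motion (fun x => x + t).
Proof. by exists idfun, t; split; first exact: surj_lin_isometry_id. Qed.

Lemma motion_id : motion idfun.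
Proof.
exists idfun, 0; split; first exact: surj_lin_isometry_id.
by apply/funext => x; rewrite addr0.
Qed.

Lemma motion_dist f x y : motion f -> N (f x - f y) = N (x - y).
Proof.
move=> [g [t [gP ->]]]; rewrite opprD addrACA subrr addr0.
by rewrite -surj_lin_isometryB//; case: gP => _ [_ [->]].
Qed.

Lemma motion_inj f : motion f -> injective f.
Proof.
move=> fP x y fxy; have [N0 [NZ _]] := normN.
apply/eqP; rewrite -subr_eq0; apply/eqP/N0.
by rewrite -(motion_dist _ _ fP) fxy subrr -(scale0r 0) NZ normr0 mul0r.
Qed.

Lemma motion_comp f g : motion f -> motion g -> motion (f \o g).
Proof.
move=> [f' [s [[fD [fZ [fN fS]]] ->]]] [g' [t [[gD [gZ [gN gS]]] ->]]].
exists (f' \o g'), (f' t + s); split; last first.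
  by apply/funext => x /=; rewrite fD addrA.
split; first by move=> x y /=; rewrite gD fD.
split; first by move=> a x /=; rewrite gZ fZ.
split; first by move=> x /=; rewrite fN gN.
by move=> y /=; have [z <-] := fS y; have [w <-] := gS z; exists w.
Qed.

Lemma motion_inv f : motion f ->
  exists g, [/\ motion g, cancel f g & cancel g f].
Proof.
move=> fP; have f_inj := motion_inj fP.
case: fP f_inj => g [t [gP ->]] f_inj.
have [gD [gZ [gN gS]]] := gP; have [h hK] := choice gS.
have g_inj : injective g by move=> x y e; apply: f_inj; rewrite e.
have hP : surj_lin_isometry N h.
  split; first by move=> x y; apply: g_inj; rewrite gD !hK.
  split; first by move=> a x; apply: g_inj; rewrite gZ !hK.
  split; first by move=> x; rewrite -gN hK.
  by move=> y; exists (g y); apply: g_inj; rewrite hK.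
exists (fun x => h x + h (- t)); split.
- by exists h, (h (- t)).
- by move=> x; apply: g_inj; rewrite gD !hK addrK.
- by move=> x; rewrite gD !hK subrK.
Qed.

Lemma image_by_motionP X Y :
  image_by_motion N X Y <-> exists2 f, motion f & Y = f @` X.
Proof.
split=> [[f [t [fP [->|->]]]]|[_ [f [t [fP ->]]] ->]].
- by exists (fun x => f x + t) => //; exists f, t.
- exists (fun x => f (x + t)) => //; exists f, (f t); split => //.
  by apply/funext => x; case: fP => ->.
- by exists f, t; split => //; left.
Qed.

(** Motions have inverses that are motions, so both directions in [congruent] amount to the same
    condition. *)
Lemma congruentP X Y : congruent N X Y <-> exists2 f, motion f & X = f @` Y.
Proof.
split=> [[]|fP]; last by right; exact/image_by_motionP.
  move=> /image_by_motionP[f fP ->]; have [g [gP fK _]] := motion_inv fP.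
  by exists g => //; rewrite image_comp; under eq_imagel do rewrite /= fK;
    rewrite image_id.
by move=> /image_by_motionP.
Qed.

Lemma congr_hypergraph_image M X f :
  congr_hypergraph N M X -> motion f -> congr_hypergraph N M (f @` X).
Proof.
move=> [T MT /congruentP[g gP ->]] fP; exists T => //; apply/congruentP.
by exists (f \o g); [exact: motion_comp|rewrite image_comp].
Qed.

Lemma congr_hypergraph_self M T : M T -> congr_hypergraph N M T.
Proof.
move=> MT; exists T => //; apply/congruentP; exists idfun; first exact: motion_id.
by rewrite image_id.
Qed.

Lemma proper_coloring_motion M (C : Type) (phi : 'rV[R]_d -> C) f :
  motion f -> proper_coloring (congr_hypergraph N M) phi ->
  proper_coloring (congr_hypergraph N M) (phi \o f).
Proof.
move=> fP prop E HE [c Ec]; apply: prop (congr_hypergraph_image HE fP) _.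
by exists c => _ [x Ex <-]; exact: Ec.
Qed.

Lemma congr_hypergraph_mgon M m X : (forall T, M T -> mgon m T) ->
  congr_hypergraph N M X -> mgon m X.
Proof.
move=> Mm [T MT /congruentP[f fP ->]]; apply: card_eq_trans (Mm _ MT).
by apply: inj_card_eq => x y _ _; exact: (motion_inj fP).
Qed.

(** Every copy of [T] contains two points at the distance of two fixed points of [T], so a coloring
    avoiding this distance leaves no copy of [T] monochromatic. The product of such colorings over
    the finite list handles all of [M]. *)
Lemma congr_colorable M : finite_set M ->
  (forall T, M T -> exists x y, [/\ T x, T y & x <> y]) ->
  exists n, colorable (congr_hypergraph N M) 'I_n.
Proof.
have [N0 [NZ ND]] := normN.
move=> /finite_seqP[s ->] M2.
suff [C [phi phiP]] : exists (C : finType) (phi : 'rV[R]_d -> C),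
    proper_coloring (congr_hypergraph N [set` s]) phi.
  exists #|C|, (enum_rank \o phi).
  exact/(proper_coloring_inj _ _ enum_rank_inj 0).
elim: s => [|T s IH] in M2 *; first by exists unit, (fun=> tt) => E [].
have [|C [phi phiP]] := IH.
  by move=> T' sT'; apply: M2; rewrite /= inE sT' orbT.
have [|x [y [Tx Ty xy]]] := M2 T; first by rewrite /= inE eqxx.
have rpos : 0 < N (x - y).
  rewrite lt_neqAle (gauge_ge0 NZ ND) andbT eq_sym.
  by apply/eqP => /N0/eqP; rewrite subr_eq0 => /eqP.
have [C' [phi' phi'P]] := distance_coloring N0 NZ ND rpos.
exists (C * C')%type, (fun z => (phi z, phi' z)).
move=> E [T' + /congruentP[f fP ->]] [[c c'] Ec].
rewrite /= inE => /orP[/eqP eT|sT'].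
  have phi'c z : T z -> phi' (f z) = c'.
    move=> Tz; suff [] : (phi (f z), phi' (f z)) = (c, c') by [].
    by apply: Ec; rewrite eT; exists z.
  by apply: (phi'P (f x) (f y)); rewrite ?motion_dist ?phi'c.
apply: (phiP (f @` T')); first by exists T' => //; apply/congruentP; exists f.
by exists c => z /Ec[].
Qed.

End Motions.

(** * Cardinalities of polygons, disjoint translates and the chromatic number *)

Lemma mgonU1 (d m : nat) (X : set 'rV[R]_d) x :
  mgon m X -> ~ X x -> mgon m.+1 (x |` X).
Proof.
rewrite /mgon => Xm nXx.
have finX : finite_set X by apply/finite_setP; exists m.
rewrite -(fset_setK finX) in Xm nXx *; move: Xm nXx => /card_eq_fsetP Xm nXx.
have -> : x |` [set` fset_set X] = [set` (x |` fset_set X)%fset].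
  apply/predeqP => y /=; rewrite in_fset1U; split.
    by case=> [->|->]; rewrite ?eqxx ?orbT.
  by move=> /orP[/eqP|]; [left|right].
apply/card_eq_fsetP; rewrite cardfsU1 Xm.
by move/negP: nXx => /= ->.
Qed.

Lemma mgon_nonempty (d m : nat) (X : set 'rV[R]_d) :
  (0 < m)%N -> mgon m X -> exists x, X x.
Proof.
move=> m0 Xm; apply: contrapT => X0; move: Xm; rewrite /mgon.
suff -> : X = set0.
  by rewrite card_eq_sym card_eq0 => /eqP/seteqP[/(_ 0%N)] + _; apply.
by apply/seteqP; split=> // x Xx; case: X0; exists x.
Qed.

Lemma mgon_two_points (d m : nat) (X : set 'rV[R]_d) :
  (1 < m)%N -> mgon m X -> exists x y, [/\ X x, X y & x <> y].
Proof.
move=> m1 Xm; have [x Xx] := mgon_nonempty (ltnW m1) Xm.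
apply: contrapT => one; suff X1 : X = [set x].
  move: Xm m1; rewrite /mgon X1 => /(card_eq_trans (card_esym card_set1)).
  by move=> /card_eq_II <-.
apply/seteqP; split=> [y Xy|_ ->//].
by apply: contrapT => xy; apply: one; exists x, y; split => // e; apply: xy.
Qed.

Lemma disjoint_translates d (j : 'I_d) (A F : set 'rV[R]_d) :
  finite_set A -> finite_set F ->
  exists t : nat -> 'rV[R]_d,
    (forall i x, F x -> ~ A (x + t i)) /\
    (forall i k x y, F x -> F y -> x + t i = y + t k -> i = k).
Proof.
move=> finA finF.
have [b bP] : exists b : R, forall x, (A `|` F) x -> `|x 0 j| <= b.
  have [s ->] : exists s : seq 'rV[R]_d, A `|` F = [set` s].
    by apply/finite_seqP; rewrite finite_setU.
  exists (\sum_(x <- s) `|x 0 j|) => x /= xs.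
  by rewrite (big_rem x)//= lerDl sumr_ge0.
(* All [j]-th coordinates in [A] and [F] lie in [[-b, b]], so shifts by distinct multiples of
   [2 * b + 1] are disjoint. The factor [i.+1] reserves the zero shift for [A]. *)
pose t i : 'rV[R]_d := ((2 * b + 1) * i.+1%:R) *: delta_mx 0 j.
have tE x i : (x + t i) 0 j = x 0 j + (2 * b + 1) * i.+1%:R.
  by rewrite !mxE !eqxx mulr1.
have sep i k x y : (A `|` F) x -> (A `|` F) y -> (i < k)%N ->
    x 0 j + (2 * b + 1) * i%:R <> y 0 j + (2 * b + 1) * k%:R.
  move=> /bP + /bP + ik; rewrite !ler_norml => /andP[x1 x2] /andP[y1 y2].
  have : (i%:R : R) + 1 <= k%:R by rewrite natr1 ler_nat.
  by move: (i%:R : R) (k%:R : R) => p q pq; nra.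
exists t; split=> [i x Fx Axt|i k x y Fx Fy].
  apply: (@sep 0%N i.+1 (x + t i) x) => //; [by left|by right|].
  by rewrite tE mulr0 addr0.
move=> /(congr1 (fun z : 'rV[R]_d => z 0 j)); rewrite !tE => e.
have [ik|ki|//] := ltngtP i k.
- by case: (@sep i.+1 k.+1 x y); [right|right| |].
- by case: (@sep k.+1 i.+1 y x); [right|right| |].
Qed.

(** An edge exists and would be monochromatic under a single color, so the chromatic number is at
    least 2. Writing it [k.+2] makes ['I_k.+1] the nonempty color set that just fails. *)
Lemma congr_chromatic_ord (d : nat) (N : 'rV[R]_d -> R) (m : nat) M :
  is_norm N -> (1 < m)%N -> M !=set0 -> finite_set M ->
  (forall T, M T -> mgon m T) ->
  exists k, chromatic_type (congr_hypergraph N M) 'I_k.+2 /\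
    ~ colorable (congr_hypergraph N M) 'I_k.+1.
Proof.
move=> normN m1 [T MT] finM Mm; set H := congr_hypergraph N M.
have exn : exists n, `[< colorable H 'I_n >].
  have [|n nP] := congr_colorable normN finM; last by exists n; apply/asboolP.
  by move=> X /Mm; exact: mgon_two_points.
case: (ex_minnP exn) => k /asboolP kP kmin.
have nontriv : (1 < k)%N.
  rewrite ltnNge; apply/negP => k1; have [phi phiP] := kP.
  apply: (phiP T); first exact: congr_hypergraph_self.
  exists (phi 0) => x _; apply/val_inj => /=.
  by have := ltn_ord (phi x); have := ltn_ord (phi 0); lia.
case: k nontriv => [|[|k]]// _ in kP kmin *; exists k; split; last first.
  by move=> /asboolP/kmin; rewrite ltnn.
split=> // D [phi phiP].
have [//|[p pk [g g_inj]]] := card_le_ord_total D k.+2.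
suff /asboolP/kmin : colorable H 'I_p by lia.
by exists (g \o phi); apply/(proper_coloring_inj _ _ g_inj 0).
Qed.

Lemma proper_coloring_superset d (N : 'rV[R]_d -> R) (M S : set (set 'rV[R]_d))
    (C : Type) (phi : 'rV[R]_d -> C) :
  is_norm N ->
  (forall Y, S Y -> exists2 X, congr_hypergraph N M X & X `<=` Y) ->
  proper_coloring (congr_hypergraph N M) phi ->
  proper_coloring (congr_hypergraph N S) phi.
Proof.
move=> normN SM phiP _ [Y /SM[X HX XY] /(congruentP normN)[f fP ->]] [c fYc].
apply: (phiP (f @` X)); first exact: congr_hypergraph_image.
by exists c => _ [x Xx <-]; apply: fYc; exists x => //; exact: XY.
Qed.

(** * The augmented polygons and the pigeonhole argument *)

Section AugmentedPolygons.
Context {d : nat} (N : 'rV[R]_d -> R) (m k : nat) (M : set (set 'rV[R]_d)).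
Hypothesis normN : is_norm N.
Hypothesis m_gt0 : (0 < m)%N.
Hypothesis Mm : forall T, M T -> mgon m T.
Variables (F : set 'rV[R]_d) (t : nat -> 'rV[R]_d) (U : set 'rV[R]_d).
Hypothesis F_critical :
  ~ colorable [set E | congr_hypergraph N M E /\ E `<=` F] 'I_k.+1.
Hypothesis M_sub : forall T, M T -> T `<=` U.
Hypothesis F_sub : forall (i : 'I_k.+2) x, F x -> U (x + t i).
Hypothesis F_disj_M : forall i x T, F x -> M T -> ~ T (x + t i).
Hypothesis F_disj : forall i j x y, F x -> F y -> x + t i = y + t j -> i = j.

(** [X] ranges over all edges of the hypergraph of [M], not only over members of [M], so that edges
    inside the translates of [F] are augmented too. *)
Definition augmented_polygons : set (set 'rV[R]_d) :=
  [set Y | [/\ Y `<=` U, mgon m.+1 Y &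
    exists2 X, congr_hypergraph N M X & X `<=` Y]].

Lemma augmented_class_eq (C : Type) (psi : 'rV[R]_d -> C) X x c :
  proper_coloring (congr_hypergraph N augmented_polygons) psi ->
  congr_hypergraph N M X -> X `<=` U -> (forall y, X y -> psi y = c) ->
  U x -> psi x = c -> X x.
Proof.
move=> psiP HX XU Xc Ux psix; apply: contrapT => nXx.
apply: (psiP (x |` X)).
  apply: congr_hypergraph_self => //; split.
  - by move=> y [->|/XU].
  - by apply: mgonU1 => //; exact: congr_hypergraph_mgon HX.
  - by exists X => // y Xy; right.
by exists c => y [->|/Xc].
Qed.

Lemma proper_coloring_augmented (phi : 'rV[R]_d -> 'I_k.+2) :
  proper_coloring (congr_hypergraph N augmented_polygons) phi ->
  proper_coloring (congr_hypergraph N M) phi.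
Proof.
move=> phiP _ [T MT /(congruentP normN)[f fP ->]] [c fTc].
(* Pulling [phi] back along [f] moves the monochromatic copy onto [T] itself, inside [U]. *)
have psiP := proper_coloring_motion normN fP phiP.
set psi := phi \o f in psiP.
have Tc x : T x -> psi x = c by move=> Tx; apply: fTc; exists x.
have F_avoids (i : 'I_k.+2) x : F x -> psi (x + t i) != c.
  move=> Fx; apply/eqP => xc; apply: (F_disj_M Fx MT).
  have HT := congr_hypergraph_self normN MT.
  exact: augmented_class_eq psiP HT (M_sub MT) Tc (F_sub i Fx) xc.
have /choice[a aP] (i : 'I_k.+2) : exists a : 'I_k.+1,
    exists X, [/\ congr_hypergraph N M X,
      forall y, X y -> exists2 x, F x & y = x + t i &
      forall y, X y -> psi y = lift c a].
  apply: contrapT => noX; apply: F_critical.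
  (* The [i]-th translate misses [c], so deleting [c] colors [F] with [k.+1] colors; the default
     [ord0] is never reached on [F]. *)
  exists (fun x => odflt ord0 (unlift c (psi (x + t i)))).
  move=> E [HE EF] [a Ea]; apply: noX; exists a, ((fun x => x + t i) @` E).
  split; first exact: congr_hypergraph_image HE (motion_shift N _).
    by move=> _ [x /EF Fx <-]; exists x.
  move=> _ [x Ex <-]; rewrite -(Ea x Ex).
  case: unliftP => [b -> //|xc].
  by have := F_avoids i x (EF x Ex); rewrite xc eqxx.
(* There are [k.+2] translates but only [k.+1] colors other than [c]. If two translates carry edges
   of the same color, a point of one edge must lie in the other, and disjointness identifies the
   translates. *)
suff a_inj : injective a by have := leq_card a a_inj; rewrite !card_ord ltnn.
move=> i j aij; have [X [HX XF Xa]] := aP i; have [Y [HY YF Ya]] := aP j.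
have [y Yy] := mgon_nonempty m_gt0 (congr_hypergraph_mgon normN Mm HY).
have [x Fx yE] := YF y Yy.
have XU : X `<=` U by move=> z /XF[w Fw ->]; exact: F_sub.
have /XF[w Fw yE'] : X y.
  apply: (augmented_class_eq psiP HX XU Xa); last by rewrite Ya// aij.
  by rewrite yE; exact: F_sub.
by apply/val_inj/(F_disj Fw Fx); rewrite -yE'.
Qed.

End AugmentedPolygons.

(** * Equivalence of the two hypergraphs *)

Theorem theorem4p3 (d : nat) (N : 'rV[R]_d -> R) (m : nat)
  (M : set (set 'rV[R]_d)) :
  is_norm N -> leq 2 m ->
  M !=set0 -> finite_set M -> (forall T, M T -> mgon m T) ->
  exists S : set (set 'rV[R]_d),
    finite_set S /\ (forall Y, S Y -> mgon m.+1 Y) /\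
    hyp_equivalent (congr_hypergraph N M) (congr_hypergraph N S).
Proof.
move=> normN m1 M0 finM Mm.
have m0 := ltnW m1.
(* Two distinct points force [d] to be positive, which gives a direction for the translations. *)
have [j _] : exists j : 'I_d, True.
  have [T /Mm/(mgon_two_points m1)[x [y [_ _ xy]]]] := M0.
  apply: contrapT => d0; apply: xy; apply/rowP => j; case: d0; by exists j.
have finT T : M T -> finite_set T by move=> /Mm Tm; apply/finite_setP; exists m.
have [k [[kP kmin] nk]] := congr_chromatic_ord normN m1 M0 finM Mm.
have [F [finF F_critical]] : exists F, finite_set F /\
    ~ colorable [set E | congr_hypergraph N M E /\ E `<=` F] 'I_k.+1.
  apply: contrapT => noF; apply: nk; apply: de_Bruijn_Erdos.
    move=> E HE; apply/finite_setP; exists m; exact: congr_hypergraph_mgon HE.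
  by move=> F finF; apply: contrapT => nF; apply: noF; exists F.
have finA : finite_set (\bigcup_(T in M) T) by exact: bigcup_finite.
have [t [FA FF]] := disjoint_translates j finA finF.
pose U := (\bigcup_(T in M) T) `|`
  \bigcup_(i in [set: 'I_k.+2]) ((fun x => x + t i) @` F).
have finU : finite_set U.
  rewrite finite_setU; split=> //; apply: bigcup_finite; first exact: finite_finset.
  by move=> i _; exact: finite_image.
pose S := augmented_polygons N m M U.
have HS_HM phi := @proper_coloring_augmented d N m k M normN m0 Mm F t U
  F_critical _ _ _ FF phi.
have {}HS_HM (phi : 'rV[R]_d -> 'I_k.+2) :
    proper_coloring (congr_hypergraph N S) phi ->
    proper_coloring (congr_hypergraph N M) phi.
  apply: HS_HM.
  - by move=> T MT x Tx; left; exists T.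
  - by move=> i x Fx; right; exists i => //; exists x.
  - by move=> i x T Fx MT Tx; apply: (FA i x Fx); exists T.
have HM_HS (C : Type) (phi : 'rV[R]_d -> C) :
    proper_coloring (congr_hypergraph N M) phi ->
    proper_coloring (congr_hypergraph N S) phi.
  by apply: proper_coloring_superset => // Y [].
exists S; split.
  by apply: sub_finite_set (finite_powerset finU) => Y [].
split; first by move=> Y [].
exists 'I_k.+2; split=> //; split.
  split; first by have [phi /HM_HS phiP] := kP; exists phi.
  move=> D [phi phiP].
  (* With fewer than [k.+2] colors, widen the palette to ['I_k.+2], where properness passes from [S]
     to [M]; injectivity of the widening brings it back to [phi], and [kmin] applies. *)
  have [//|[p pk [g g_inj]]] := card_le_ord_total D k.+2.
  apply: kmin; exists phi.
  have w_inj : injective (widen_ord (ltnW pk) \o g).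
    by apply: inj_comp g_inj => a b /(congr1 val)/= ?; exact: val_inj.
  apply/(proper_coloring_inj _ _ w_inj 0)/HS_HM.
  by apply/(proper_coloring_inj _ _ w_inj 0).
(* One implication holds for every color set; the other is transported to ['I_k.+2] along [h']. *)
move=> D [h [h' hK h'K]] phi; split; first exact: HM_HS.
have h'_inj := can_inj h'K => phiP.
apply/(proper_coloring_inj _ _ h'_inj 0)/HS_HM.
by apply/(proper_coloring_inj _ _ h'_inj 0).
Qed.
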